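(* Assume that the left boundary kernel $K^L(\cdot;\alpha)$, $\alpha\in\,]0,1[$, satisfies $$\alpha\,(1-\mu_{0,L}(\alpha))+\mu_{1,L}(\alpha)=0\quad\text{for all }\alpha\in\,]0,1[,$$ and $$\sup_{\alpha\in\,]0,1[}|\mu_{0,L}|(\alpha)<\infty,$$ and that the restriction of $F$ to the interval $[a,b]$ is twice continuously differentiable. Then, as $n\to\infty$ (with $h=h_n\to0$): a) $$\sup_{x\in\,]a,a+h[}\left|\mathrm{E}\tilde F_{nh}(x)-F(x)-\frac{h^2}{2}F''(x)\,\mu_L\big((x-a)/h\big)\right|=o(h^2),$$ where $\mu_L(\alpha)=\mu_{2,L}(\alpha)-\alpha\,\mu_{1,L}(\alpha)$ for $\alpha\in\,]0,1[$; b) $$\sup_{x\in\,]a,a+h[}\left|\mathrm{Var}\,\tilde F_{nh}(x)-\frac{F(x)(1-F(x))}{n}+\frac{h}{n}F'(x)\,\nu_L\big((x-a)/h\big)\right|=O(n^{-1}h^2),$$ where $\nu_L(\alpha)=m_{1,L}(\alpha)+\alpha\big(1-\mu_{0,L}(\alpha)^2\big)$ for $\alpha\in\,]0,1[$, with $m_{1,L}(\alpha)=\int u\,B^L(u;\alpha)\,du$ and $B^L(u;\alpha)=2\bar K^L(u;\alpha)K^L(u;\alpha)$.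
   Context: $X_1,\dots,X_n$ are independent copies of an absolutely continuous real random variable with density $f$ and distribution function $F$, where the support of $f$ is the finite interval $[a,b]$. Integrals without limits are over the whole real line. $K$ is a kernel on $\mathbb{R}$, i.e. a bounded and symmetric probability density function with support $[-1,1]$, and $\bar K(u)=\int_{-\infty}^u K(v)\,dv$. The bandwidth $h=h_n$ is a sequence of strictly positive real numbers converging to zero as $n\to\infty$, with $0<h\le (b-a)/2$. Left boundary kernel: for each $\alpha\in\,]0,1[$, $K^L(\cdot;\alpha)$ is a real function on $\mathbb{R}$ with support contained in $[-1,\alpha]$ and $|\mu_{0,L}|(\alpha):=\int|K^L(u;\alpha)|\,du<\infty$. For $k\in\{0,1,2,\dots\}$, $\mu_{k,L}(\alpha)=\int u^kK^L(u;\alpha)\,du$. The right boundary kernel is $K^R(u;\alpha)=K^L(-u;\alpha)$. Put $$\bar K^L(u;\alpha)=\int_{-\infty}^uK^L(v;\alpha)\,dv,\qquad \bar K^R(u;\alpha)=1-\int_u^{+\infty}K^R(v;\alpha)\,dv.$$ The boundary modified kernel distribution function estimator is $\tilde F_{nh}(x)=0$ for $x\le a$, $\tilde F_{nh}(x)=1$ for $x\ge b$, and for $a<x<b$, $$\tilde F_{nh}(x)=\frac1n\sum_{i=1}^n\bar K_{x,h}\Big(\frac{x-X_i}{h}\Big),$$ where $\bar K_{x,h}(u)=\bar K^L(u;(x-a)/h)$ if $a<x<a+h$, $\bar K_{x,h}(u)=\bar K(u)$ if $a+h\le x\le b-h$, and $\bar K_{x,h}(u)=\bar K^R(u;(b-x)/h)$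 if $b-h<x<b$. *)

(* Defs.v *)
From HB Require Import structures.
From mathcomp Require Export all_boot all_order all_algebra finmap.
From mathcomp Require Export all_classical all_reals all_analysis.
Export Order.TTheory GRing.Theory Num.Theory numFieldNormedType.Exports.

Set Implicit Arguments.
Unset Strict Implicit.
Unset Printing Implicit Defensive.

Local Open Scope classical_set_scope.
Local Open Scope ring_scope.

Definition fun_support (R : realType) (g : R -> R) : set R :=
  closure [set x | g x != 0].

Definition mutually_independent d (T : measurableType d) (R : realType)
    (P : probability T R) (X : nat -> {RV P >-> R}) : Prop :=
  forall (J : {fset nat}) (A : nat -> set R), (forall i, measurable (A i)) ->
    (P (\bigcap_(i in [set` J]) X i @^-1` A i) =
     \prod_(i <- J) P (X i @^-1` A i))%E.

Definition has_density d (T : measurableType d) (R : realType)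
    (P : probability T R) (X : {RV P >-> R}) (f : R -> R) : Prop :=
  [/\ measurable_fun setT f, (forall x, 0 <= f x) &
      forall A : set R, measurable A ->
        distribution P X A = (\int[lebesgue_measure]_(x in A) (f x)%:E)%E].

(* g' is the derivative of the restriction of g to A: difference quotients are
   taken inside A, so at an endpoint of an interval they are one-sided. *)
Definition has_derive_within (R : realType) (A : set R) (g g' : R -> R) : Prop :=
  forall x, A x -> (g y - g x) / (y - x) @[y --> within A x^'] --> g' x.

Definition twice_continuously_differentiable_within (R : realType)
    (A : set R) (g : R -> R) : Prop :=
  exists g1 g2 : R -> R, [/\ has_derive_within A g g1,
    has_derive_within A g1 g2 & {within A, continuous g2}].

Definition is_kernel (R : realType) (K : R -> R) : Prop :=
  [/\ measurable_fun setT K, (forall u, 0 <= K u) &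
      (\int[lebesgue_measure]_u (K u)%:E = 1)%E] /\
  [/\ bounded_fun K, (forall u, K (- u) = K u) & fun_support K = `[-1, 1]%classic].

Definition Kbar (R : realType) (K : R -> R) (u : R) : R :=
  \int[lebesgue_measure]_(v in `]-oo, u]) K v.

(* A left boundary kernel K^L(u; alpha) is written [KL alpha u]; only the values
   alpha in ]0, 1[ are meaningful. *)
Definition is_left_boundary_kernel (R : realType) (KL : R -> R -> R) : Prop :=
  forall alpha : R, alpha \in `]0, 1[ ->
    fun_support (KL alpha) `<=` `[-1, alpha]%classic /\
    lebesgue_measure.-integrable setT (EFin \o KL alpha).

Definition right_kernel (R : realType) (KL : R -> R -> R) (alpha u : R) : R :=
  KL alpha (- u).

Definition KbarL (R : realType) (KL : R -> R -> R) (alpha u : R) : R :=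
  Kbar (KL alpha) u.

Definition KbarR (R : realType) (KL : R -> R -> R) (alpha u : R) : R :=
  1 - \int[lebesgue_measure]_(v in `[u, +oo[) right_kernel KL alpha v.

Definition moment (R : realType) (KL : R -> R -> R) (k : nat) (alpha : R) : R :=
  \int[lebesgue_measure]_u (u ^+ k * KL alpha u).

Definition abs_moment0 (R : realType) (KL : R -> R -> R) (alpha : R) : \bar R :=
  (\int[lebesgue_measure]_u `|KL alpha u|%:E)%E.

Definition muL (R : realType) (KL : R -> R -> R) (alpha : R) : R :=
  moment KL 2 alpha - alpha * moment KL 1 alpha.

Definition BL (R : realType) (KL : R -> R -> R) (alpha u : R) : R :=
  2 * KbarL KL alpha u * KL alpha u.

Definition m1L (R : realType) (KL : R -> R -> R) (alpha : R) : R :=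
  \int[lebesgue_measure]_u (u * BL KL alpha u).

Definition nuL (R : realType) (KL : R -> R -> R) (alpha : R) : R :=
  m1L KL alpha + alpha * (1 - moment KL 0 alpha ^+ 2).

(* Meaningful for a < x < b and 0 < h <= (b - a) / 2. *)
Definition Kbar_xh (R : realType) (K : R -> R) (KL : R -> R -> R)
    (a b h x u : R) : R :=
  if x < a + h then KbarL KL ((x - a) / h) u
  else if x <= b - h then Kbar K u
  else KbarR KL ((b - x) / h) u.

(* The sample X_1, ..., X_n is [X 0, ..., X n.-1]. *)
Definition Ftilde d (T : measurableType d) (R : realType) (P : probability T R)
    (X : nat -> {RV P >-> R}) (K : R -> R) (KL : R -> R -> R)
    (a b : R) (n : nat) (h x : R) (w : T) : R :=
  if x <= a then 0
  else if b <= x then 1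
  else n%:R^-1 * \sum_(i < n) Kbar_xh K KL a b h x ((x - X i w) / h).

(* A supremum is an extended real; finiteness is part of the assertion because
   [fine] sends infinite values to 0. *)
Definition elittleo (R : realType) (s : nat -> \bar R) (e : nat -> R) : Prop :=
  (\forall n \near \oo, s n \is a fin_num) /\ (fun n => fine (s n)) =o_\oo e.

Definition ebigO (R : realType) (s : nat -> \bar R) (e : nat -> R) : Prop :=
  (\forall n \near \oo, s n \is a fin_num) /\ (fun n => fine (s n)) =O_\oo e.

(* Main.v *)
Require Import Defs.
From mathcomp Require Import measurable_realfun ring lra.

Set Implicit Arguments.
Unset Strict Implicit.
Unset Printing Implicit Defensive.

Local Open Scope classical_set_scope.
Local Open Scope ring_scope.

(* By Fubini, [E Kbar_G ((x - X) / h) = \int G(v) F(x - h v) dv] for every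
   integrable [G].  When [x = a + alpha h] and [G] lives on [-1, alpha], all the
   points [x - h v] lie in [a, a + 2 h], so [F] can be replaced by its Taylor
   polynomial at [x].  Since [F a = 0] and
   [alpha (1 - mu_0) + mu_1 = 0], what remains of the terms in [F x] and [F' x]
   is [1 - mu_0] times the Taylor remainder at [a = x - h alpha].  For the
   variance, [Kbar_G ^ 2 = Kbar_B] with [B = 2 Kbar_G G], whose total mass is
   [mu_0 ^ 2], so the second moment is again an integral of the same form; the
   covariances vanish by applying Fubini in both variables to
   [P (u <= Y_i, v <= Y_j) = P (u <= Y_i) P (v <= Y_j)]. *)

(** * Fubini for an integrand [g1 x * g2 y] restricted to a measurable set [S] *)

Section fubini_section.
Context d1 d2 (T1 : measurableType d1) (T2 : measurableType d2) (R : realType).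
Variables (m1 : {sigma_finite_measure set T1 -> \bar R}).
Variables (m2 : {sigma_finite_measure set T2 -> \bar R}).
Variables (S : set (T1 * T2)) (g1 : T1 -> R) (g2 : T2 -> R).
Hypotheses (mS : measurable S).
Hypotheses (ig1 : m1.-integrable setT (EFin \o g1)).
Hypotheses (ig2 : m2.-integrable setT (EFin \o g2)).

Let f (z : T1 * T2) : \bar R := (\1_S z * (g1 z.1 * g2 z.2))%:E.

Let mf : measurable_fun setT f.
Proof.
have mg1 : measurable_fun setT g1 by apply/measurable_EFinP/measurable_int/ig1.
have mg2 : measurable_fun setT g2 by apply/measurable_EFinP/measurable_int/ig2.
apply/measurable_EFinP/measurable_funM; first exact: measurable_indic.
by apply: measurable_funM; exact: measurableT_comp.
Qed.

(** By Tonelli it suffices to bound the iterated integral of the absolute value. The indicator is at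
    most 1, so the inner integral is at most [|g1 x|] times the finite constant [c], the integral of
    [|g2|]. *)
Let int_f : (m1 \x m2)%E.-integrable setT f.
Proof.
apply/(integrable12ltyP _ _ mf).
pose c := (\int[m2]_y `|(g2 y)%:E|)%E.
have c_fin : c \is a fin_num.
  by apply: integrable_fin_num => //; exact: integrable_abse ig2.
have mg1 : measurable_fun setT (EFin \o g1) by apply/measurable_int/ig1.
have mg2 : measurable_fun setT (EFin \o g2) by apply/measurable_int/ig2.
apply: (@le_lt_trans _ _ (\int[m1]_x (`|(g1 x)%:E| * c))%E).
  apply: ge0_le_integral => //.
  - by move=> x _; exact: integral_ge0.
  - apply: (measurable_fun_fubini_tonelli_F (abse \o f)) => //=.
    exact: measurableT_comp.
  - by apply: emeasurable_funM => //; exact: measurableT_comp.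
  - move=> x _; rewrite -ge0_integralZl//; last exact: measurableT_comp.
    apply: ge0_le_integral => //.
    + apply: measurableT_comp => //.
      exact: measurableT_comp mf _.
    + by apply: emeasurable_funM => //; exact: measurableT_comp.
    + move=> y _ /=; rewrite -EFinM lee_fin normrM normrM.
      rewrite ger0_norm ?indicE//.
      by rewrite ler_piMl ?mulr_ge0//; case: (_ \in S) => /=.
under eq_integral do rewrite muleC.
rewrite ge0_integralZl//; last 2 first.
  exact: measurableT_comp.
  exact: integral_ge0.
rewrite lte_mul_pinfty//; first exact: integral_ge0.
by have /integrableP[] := ig1.
Qed.

Lemma integrable_xsection x : m2.-integrable (xsection S x) (EFin \o g2).
Proof. by apply: integrableS ig2 => //; exact: measurable_xsection. Qed.

Lemma integrable_ysection y : m1.-integrable (ysection S y) (EFin \o g1).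
Proof. by apply: integrableS ig1 => //; exact: measurable_ysection. Qed.

Let fubini_FE : fubini_F m2 f =
  EFin \o (fun x => g1 x * \int[m2]_(y in xsection S x) g2 y).
Proof.
apply/funext => x; rewrite /fubini_F /= EFinM /Rintegral fineK; last first.
  by apply: integrable_fin_num (integrable_xsection x); exact: measurable_xsection.
rewrite -integralZl//; [|exact: measurable_xsection|exact: integrable_xsection].
rewrite [RHS]integral_mkcond; apply: eq_integral => y _.
by rewrite /f patchE mem_xsection indicE /=; case: ifPn => _; rewrite ?mul1r ?mul0r.
Qed.

Let fubini_GE : fubini_G m1 f =
  EFin \o (fun y => g2 y * \int[m1]_(x in ysection S y) g1 x).
Proof.
apply/funext => y; rewrite /fubini_G /= EFinM /Rintegral fineK; last first.
  by apply: integrable_fin_num (integrable_ysection y); exact: measurable_ysection.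
rewrite -integralZl//; [|exact: measurable_ysection|exact: integrable_ysection].
rewrite [RHS]integral_mkcond; apply: eq_integral => x _.
rewrite /f patchE mem_ysection indicE /=.
by case: ifPn => _; rewrite ?mul1r ?mul0r// mulrC.
Qed.

Lemma integrable_Rintegral_xsection :
  m1.-integrable setT
    (EFin \o (fun x => g1 x * \int[m2]_(y in xsection S x) g2 y)).
Proof. by rewrite -fubini_FE; exact: integrable_fubini_F. Qed.

(** The two sides are the iterated integrals of [f]: in each, the indicator of [S] cuts the inner
    integral down to a section and the factor in the outer variable comes out. *)
Lemma Rintegral_Fubini_section :
  \int[m1]_x (g1 x * \int[m2]_(y in xsection S x) g2 y) =
  \int[m2]_y (g2 y * \int[m1]_(x in ysection S y) g1 x).
Proof.
have := Fubini int_f; rewrite -/(fubini_F m2 f).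
move/(congr1 fine) => e; rewrite /Rintegral.
transitivity (fine (\int[m1]_x (fubini_F m2 f x)))%E; first by rewrite fubini_FE.
by rewrite [LHS]e; rewrite -/(fubini_G m1 f) fubini_GE.
Qed.

End fubini_section.

(** * Measurability and boundedness of [Kbar G] *)

Section kernel_distribution.
Context (R : realType).
Local Notation mu := (@lebesgue_measure R).
Implicit Types G : R -> R.

Lemma measurable_le_set d (T : measurableType d) (Y : T -> R) :
  measurable_fun setT Y -> measurable [set p : T * measurableTypeR R | p.2 <= Y p.1].
Proof.
move=> mY; rewrite -[X in measurable X]setTI.
by apply: measurable_fun_ler => //; exact: measurableT_comp.
Qed.

(** Puts [Kbar G (Y w)] in the shape of an inner integral over a section, so that Fubini applies
    with [w] as the outer variable. *)
Lemma KbarE G d (T : measurableType d) (Y : T -> R) (w : T) :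
  Kbar G (Y w) =
  \int[mu]_(v in xsection [set p : T * measurableTypeR R | p.2 <= Y p.1] w) G v.
Proof.
rewrite /Kbar; congr Rintegral.
by apply/seteqP; split => v; rewrite /xsection/= in_itv/= inE.
Qed.

Lemma Kbar_measurable G : mu.-integrable setT (EFin \o G) ->
  measurable_fun setT (Kbar G).
Proof.
(* The Dirac mass is a dummy first measure: only the measurability part of
   [integrable_Rintegral_xsection] is of interest here. *)
move=> iG; pose m : probability R R := \d_(0 : R).
have i1 : m.-integrable setT (EFin \o (fun=> 1 : R)).
  exact: finite_measure_integrable_cst.
have := integrable_Rintegral_xsection
  (measurable_le_set (@measurable_id _ R setT)) i1 iG.
move=> /measurable_int/measurable_EFinP; apply: eq_measurable_fun => u _.
by rewrite mul1r [RHS](KbarE G (@idfun R)).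
Qed.

Lemma Kbar_bounded G u : mu.-integrable setT (EFin \o G) ->
  `|Kbar G u| <= \int[mu]_v `|G v|.
Proof.
move=> iG; apply: (@le_trans _ _ (\int[mu]_(v in `]-oo, u]) `|G v|)).
  by apply: le_normr_Rintegral => //; apply: integrableS iG.
rewrite fine_le//.
- apply: integrable_fin_num => //.
  exact: (integrableS measurableT _ _ (integrable_norm iG)).
- by apply: integrable_fin_num => //; exact: integrable_norm.
- apply: ge0_subset_integral => //.
  by apply/measurable_int/integrable_norm/iG.
Qed.

End kernel_distribution.

(** * Expectations involving [Kbar G] *)

Section expectation_Kbar.
Context d (T : measurableType d) (R : realType) (P : probability T R).
Local Notation mu := (@lebesgue_measure R).

(** The weight [Z] lets one exchange serve several times: [Z = 1] gives the mean, while [Z] equal to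
    another smoothed variable, and then to an indicator, gives the cross moments. *)
Lemma Rintegral_mul_Kbar (G : R -> R) (Z Y : T -> R) :
  mu.-integrable setT (EFin \o G) -> P.-integrable setT (EFin \o Z) ->
  measurable_fun setT Y ->
  \int[P]_w (Z w * Kbar G (Y w)) =
  \int[mu]_v (G v * \int[P]_(w in [set w | v <= Y w]) Z w).
Proof.
move=> iG iZ mY.
transitivity (\int[P]_w (Z w * \int[mu]_(v in
    xsection [set p : T * measurableTypeR R | p.2 <= Y p.1] w) G v)).
  by apply: eq_Rintegral => w _; rewrite -KbarE.
rewrite (Rintegral_Fubini_section (measurable_le_set mY) iZ iG).
apply: eq_Rintegral => v _; congr (_ * _); congr Rintegral.
by apply/seteqP; split => w; rewrite /ysection/= inE.
Qed.

End expectation_Kbar.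

(** * Integrability, domination and finite sums for real-valued integrals *)

Section Rintegral_complements.
Context d (T : measurableType d) (R : realType).
Variable mu : {measure set T -> \bar R}.

Lemma integrableZl_EFin (k : R) (f : T -> R) :
  mu.-integrable setT (EFin \o f) ->
  mu.-integrable setT (EFin \o (fun x => k * f x)).
Proof.
move=> fi; rewrite (_ : _ \o _ = fun x => k%:E * (f x)%:E)%E//.
exact: integrableZl.
Qed.

Lemma integrableD_EFin (f g : T -> R) : mu.-integrable setT (EFin \o f) ->
  mu.-integrable setT (EFin \o g) ->
  mu.-integrable setT (EFin \o (fun x => f x + g x)).
Proof. by move=> fi gi; exact: (integrableD measurableT fi gi). Qed.

Lemma integrableB_EFin (f g : T -> R) : mu.-integrable setT (EFin \o f) ->
  mu.-integrable setT (EFin \o g) ->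
  mu.-integrable setT (EFin \o (fun x => f x - g x)).
Proof. by move=> fi gi; exact: (integrableB measurableT fi gi). Qed.

Lemma integrable_dominated (M : R) (G H : T -> R) :
  mu.-integrable setT (EFin \o G) -> measurable_fun setT H ->
  (forall v, `|H v| <= M * `|G v|) -> mu.-integrable setT (EFin \o H).
Proof.
move=> iG mH HG.
apply: (@le_integrable _ _ _ mu setT _ _ (fun v => (M * G v)%:E)) => //.
- exact/measurable_EFinP.
- move=> v _ /=; rewrite lee_fin normrM (le_trans (HG v))//.
  by rewrite ler_wpM2r// ler_norm.
- exact: integrableZl_EFin.
Qed.

Lemma normr_Rintegral_dominated (M : R) (G H : T -> R) :
  mu.-integrable setT (EFin \o G) -> measurable_fun setT H ->
  (forall v, `|H v| <= M * `|G v|) ->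
  `|\int[mu]_v H v| <= M * \int[mu]_v `|G v|.
Proof.
move=> iG mH HG; have iH := integrable_dominated iG mH HG.
apply: le_trans (le_normr_Rintegral _ iH) _ => //.
have inG := integrable_norm iG.
rewrite -RintegralZl//; apply: le_Rintegral => //.
- exact: integrable_norm.
- exact: integrableZl_EFin.
Qed.

Lemma integrable_sum_EFin (I : Type) (s : seq I) (f : I -> T -> R) :
  (forall i, mu.-integrable setT (EFin \o f i)) ->
  mu.-integrable setT (EFin \o (fun x => \sum_(i <- s) f i x)).
Proof.
move=> fi; have := integrable_sum measurableT s (P := predT) (fun i _ => fi i).
by apply: eq_integrable => // x _; rewrite /= sumEFin.
Qed.

Lemma Rintegral_sum (I : Type) (s : seq I) (f : I -> T -> R) :
  (forall i, mu.-integrable setT (EFin \o f i)) ->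
  \int[mu]_x (\sum_(i <- s) f i x) = \sum_(i <- s) \int[mu]_x f i x.
Proof.
move=> fi; elim: s => [|i s ih].
  under eq_Rintegral do rewrite big_nil.
  by rewrite big_nil /Rintegral integral0.
under eq_Rintegral do rewrite big_cons.
rewrite big_cons -ih RintegralD//.
exact: integrable_sum_EFin.
Qed.

End Rintegral_complements.

(** * The square of [Kbar G] as the primitive of [2 * Kbar G * G] *)

Section square_of_Kbar.
Context (R : realType).
Local Notation mu := (@lebesgue_measure R).
Implicit Types G : R -> R.

(* [lebesgue_measure] lives on [measurableTypeR R], whose measurable structure is
   convertible but not syntactically equal to the default one on [R]. *)
Lemma lebesgue_integrable_measurable G : mu.-integrable setT (EFin \o G) ->
  measurable_fun setT G.
Proof.
move=> /measurable_int mG.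
have : measurable_fun [set: measurableTypeR R] G by exact/measurable_EFinP.
exact.
Qed.

Lemma Kbar_dominated G v : mu.-integrable setT (EFin \o G) ->
  `|2 * Kbar G v * G v| <= 2 * (\int[mu]_u `|G u|) * `|G v|.
Proof.
move=> iG; rewrite normrM ler_wpM2r// normrM ger0_norm//.
by rewrite ler_wpM2l// Kbar_bounded.
Qed.

Lemma measurable_mul_Kbar G : mu.-integrable setT (EFin \o G) ->
  measurable_fun setT (fun v => 2 * Kbar G v * G v).
Proof.
move=> iG; apply: measurable_funM.
  by apply: measurable_funM => //; exact: Kbar_measurable.
exact: lebesgue_integrable_measurable.
Qed.

Lemma integrable_mul_Kbar G : mu.-integrable setT (EFin \o G) ->
  mu.-integrable setT (EFin \o (fun v => 2 * Kbar G v * G v)).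
Proof.
move=> iG; apply: (integrable_dominated iG (measurable_mul_Kbar iG)).
by move=> v; exact: Kbar_dominated.
Qed.

(* Fubini exchanges the two triangles [w <= v] and [v <= w]; together they
   cover the plane, so each carries half of the square. *)
Lemma Rintegral_mul_Kbar_sq G : mu.-integrable setT (EFin \o G) ->
  \int[mu]_v (2 * Kbar G v * G v) = (\int[mu]_v G v) ^+ 2.
Proof.
move=> iG; have iB := integrable_mul_Kbar iG.
have mid : measurable_fun setT (@idfun R) by exact: measurable_id.
pose S := [set p : measurableTypeR R * measurableTypeR R | p.2 <= p.1].
have mS : measurable S := measurable_le_set mid.
have e1 v : Kbar G v = \int[mu]_(w in xsection S v) G w.
  exact: (KbarE G (@idfun R)).
have i1 : mu.-integrable setT (EFin \o (fun v => G v * Kbar G v)).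
  have := integrable_Rintegral_xsection mS iG iG.
  by apply: eq_integrable => // v _; rewrite /= e1.
have e2 v : \int[mu]_(w in ysection S v) G w = (\int[mu]_w G w) - Kbar G v.
  have -> : ysection S v = `[v, +oo[%classic.
    by apply/seteqP; split => w; rewrite /ysection/= in_itv/= inE andbT.
  have -> : \int[mu]_w G w = \int[mu]_(w in `]-oo, v] `|` `]v, +oo[) G w.
    by congr Rintegral; rewrite -setCitvl setUv.
  rewrite Rintegral_setU//; last 2 first.
  - by apply: integrableS iG => //; exact: measurableU.
  - by rewrite -setCitvl; apply/disj_setPCl.
  rewrite /Kbar addrAC subrr add0r.
  rewrite Rintegral_itv_obnd_cbnd//.
  by apply: integrableS iG.
have h1 := Rintegral_Fubini_section mS iG iG.
have E : \int[mu]_v (G v * Kbar G v) =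
    (\int[mu]_w G w) ^+ 2 - \int[mu]_v (G v * Kbar G v).
  transitivity (\int[mu]_v (G v * \int[mu]_(w in xsection S v) G w)).
    by apply: eq_Rintegral => v _; rewrite -e1.
  rewrite h1 expr2 -RintegralZl// -RintegralB//; last first.
    exact: integrableZl_EFin.
  by apply: eq_Rintegral => v _; rewrite e2 mulrBr [G v * \int[_]_w _]mulrC.
have -> : \int[mu]_v (2 * Kbar G v * G v) = 2 * \int[mu]_v (G v * Kbar G v).
  rewrite -RintegralZl//; apply: eq_Rintegral => v _.
  by rewrite -mulrA [Kbar _ _ * _]mulrC.
by rewrite mulr_natl mulr2n {2}E addrC subrK.
Qed.

(** This is the full-line identity applied to [G] truncated to []-oo, u]]. Truncation leaves
    [Kbar G v] unchanged for [v <= u], and for [v > u] the factor [g v] is zero. No continuity of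
    [G] enters, so differentiating [Kbar G ^ 2] is avoided. *)
Lemma Kbar_mul_Kbar G u : mu.-integrable setT (EFin \o G) ->
  Kbar (fun v => 2 * Kbar G v * G v) u = Kbar G u ^+ 2.
Proof.
move=> iG; pose g : R -> R := G \_ `]-oo, u].
have ig : mu.-integrable setT (EFin \o g).
  have iGu : mu.-integrable `]-oo, u] (EFin \o G) by apply: integrableS iG.
  rewrite /g -restrict_EFin.
  exact: ((@integrable_mkcond _ _ _ mu _ _ (measurable_itv _)).1 iGu).
have -> : Kbar G u = \int[mu]_v g v by rewrite /Kbar Rintegral_mkcond.
rewrite -(Rintegral_mul_Kbar_sq ig) /Kbar Rintegral_mkcond.
apply: eq_Rintegral => v _; rewrite /g patchE [in RHS]patchE.
case: ifPn => uv; last by rewrite mulr0.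
congr (_ * _ * _); apply: eq_Rintegral => w /[!inE]/= /[!in_itv]/= wv.
move: uv; rewrite inE/= in_itv/= => vu.
by rewrite patchE mem_set//= in_itv/= (le_trans wv).
Qed.

End square_of_Kbar.

(** * Mean and variance of an average of bounded, pairwise uncorrelated variables *)

Section bounded_random_variables.
Context d (T : measurableType d) (R : realType) (P : probability T R).

Lemma bounded_measurable_integrable (C : R) (Z : T -> R) :
  measurable_fun setT Z -> (forall w, `|Z w| <= C) ->
  P.-integrable setT (EFin \o Z).
Proof.
move=> mZ ZC; have i1 : P.-integrable setT (EFin \o (fun=> 1 : R)).
  exact: finite_measure_integrable_cst.
apply: (integrable_dominated (M := C) i1 mZ) => w.
by rewrite normr1 mulr1.
Qed.

Lemma expectation_Rintegral (Z : T -> R) : P.-integrable setT (EFin \o Z) ->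
  'E_P[Z]%E = (\int[P]_w Z w)%:E.
Proof.
by move=> iZ; rewrite unlock /Rintegral fineK//; exact: integrable_fin_num iZ.
Qed.

Lemma Rintegral_cst_prob (c : R) : \int[P]_w c = c.
Proof.
rewrite (Rintegral_cst P measurableT) [X in fine X](probability_setT P).
by rewrite mulr1.
Qed.

Variables (C m s : R) (Z : nat -> T -> R).
Hypothesis mZ : forall i, measurable_fun setT (Z i).
Hypothesis ZC : forall i w, `|Z i w| <= C.
Hypothesis Zm : forall i, \int[P]_w Z i w = m.

Let iZ i : P.-integrable setT (EFin \o Z i).
Proof. exact: bounded_measurable_integrable (mZ i) (ZC i). Qed.

Lemma expectation_mean n : (0 < n)%N ->
  'E_P[(fun w => n%:R^-1 * \sum_(i < n) Z i w)%R]%E = m%:E.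
Proof.
move=> n0; have isum : P.-integrable setT (EFin \o fun w => \sum_(i < n) Z i w).
  by apply: integrable_sum_EFin => i; exact: iZ.
rewrite expectation_Rintegral; last first.
  exact: integrableZl_EFin.
rewrite RintegralZl// Rintegral_sum; last by move=> i; exact: iZ.
under eq_bigr do rewrite Zm.
rewrite sumr_const card_ord -[m *+ n]mulr_natl mulrA mulVf ?mul1r//.
by rewrite pnatr_eq0 -lt0n.
Qed.

Hypothesis Zs : forall i, \int[P]_w (Z i w * Z i w) = s.
Hypothesis Zij : forall i j, i != j -> \int[P]_w (Z i w * Z j w) = m * m.

(** The squared deviation of the average is a double sum of products of centred variables. Off the
    diagonal their integrals vanish by [Zij], and each of the [n] diagonal terms contributes
    [s - m ^+ 2]. *)
Lemma variance_mean n : (0 < n)%N ->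
  'V_P[(fun w => n%:R^-1 * \sum_(i < n) Z i w)%R]%E = ((s - m ^+ 2) / n%:R)%:E.
Proof.
move=> n0.
have n1 : n%:R != 0 :> R by rewrite pnatr_eq0 -lt0n.
rewrite /variance unlock expectation_mean//=.
have iZZ i j : P.-integrable setT (EFin \o fun w => (Z i w - m) * (Z j w - m)).
  have b k w : `|Z k w - m| <= C + `|m|.
    by rewrite (le_trans (ler_normB _ _))// lerD2r.
  apply: (@bounded_measurable_integrable ((C + `|m|) * (C + `|m|))).
    by apply: measurable_funM; apply: measurable_funB.
  by move=> w; rewrite normrM ler_pM.
have E i j : \int[P]_w ((Z i w - m) * (Z j w - m)) =
    if i == j then s - m ^+ 2 else 0.
  have iZij : P.-integrable setT (EFin \o fun w => Z i w * Z j w).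
    apply: (@bounded_measurable_integrable (C * C)).
      exact: measurable_funM.
    by move=> w; rewrite normrM ler_pM.
  have imZ k : P.-integrable setT (EFin \o fun w => m * Z k w).
    exact: integrableZl_EFin.
  have ic : P.-integrable setT (EFin \o fun=> m * m).
    exact: finite_measure_integrable_cst.
  transitivity (\int[P]_w (((Z i w * Z j w - m * Z i w) - m * Z j w) + m * m)).
    by apply: eq_Rintegral => w _; rewrite mulrBr !mulrBl; ring.
  rewrite RintegralD//; last by do 2 apply: integrableB_EFin => //.
  rewrite RintegralB//; last exact: integrableB_EFin.
  rewrite RintegralB//.
  rewrite (RintegralZl m measurableT (iZ i)) (RintegralZl m measurableT (iZ j)).
  rewrite !Zm Rintegral_cst_prob.
  case: eqVneq => [->|ij]; first by rewrite Zs; ring.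
  by rewrite Zij//; ring.
pose c : R := n%:R^-1 * n%:R^-1.
pose W w := c * \sum_(i < n) \sum_(j < n) (Z i w - m) * (Z j w - m).
transitivity ('E_P[W])%E.
  congr expectation; apply/funext => w.
  pose D := n%:R^-1 * \sum_(i < n) Z i w - m; transitivity (D * D) => //.
  have -> : D = n%:R^-1 * \sum_(i < n) (Z i w - m).
    rewrite /D sumrB sumr_const card_ord mulrBr -[m *+ n]mulr_natl.
    by rewrite mulrA mulVf// mul1r.
  rewrite mulrACA; congr (_ * _); rewrite mulr_suml.
  by apply: eq_bigr => i _; rewrite mulr_sumr.
have i1 : P.-integrable setT
    (EFin \o fun w => \sum_(i < n) \sum_(j < n) (Z i w - m) * (Z j w - m)).
  by apply: integrable_sum_EFin => i; apply: integrable_sum_EFin.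
rewrite expectation_Rintegral; last exact: integrableZl_EFin.
congr EFin; rewrite RintegralZl// Rintegral_sum; last first.
  by move=> i; exact: integrable_sum_EFin.
under eq_bigr => i _.
  rewrite Rintegral_sum//.
  under eq_bigr do rewrite E.
  rewrite (bigD1 i)//= eqxx big1 ?addr0; last first.
    by move=> j /negPf ji; rewrite -val_eqE eq_sym /= in ji *; rewrite ji.
  over.
rewrite sumr_const card_ord -[_ *+ n]mulr_natl /c.
by rewrite mulrACA [n%:R^-1 * (s - _)]mulrC mulVf ?mul1r.
Qed.

End bounded_random_variables.

(** * The rescaled sample [(x - X i) / h]: tail probabilities and product moments *)

Section smoothed_sample.
Context d (T : measurableType d) (R : realType) (P : probability T R).
Variables (X : nat -> {RV P >-> R}) (F : R -> R).
Hypothesis X_indep : mutually_independent X.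
Hypothesis X_cdf : forall i x, cdf (X i) x = (F x)%:E.
Local Notation mu := (@lebesgue_measure R).
Variables (h x : R).
Hypothesis h_gt0 : 0 < h.

Local Notation Y i w := ((x - X i w) / h).

Lemma measurable_scaled_sample i : measurable_fun setT (fun w => Y i w).
Proof.
by apply: measurable_funM => //; exact: measurable_funB.
Qed.

Lemma scaled_sample_set i v : [set w | v <= Y i w] = X i @^-1` `]-oo, x - h * v].
Proof.
apply/seteqP; split => w /=; rewrite in_itv/= ler_pdivlMr// [h * v]mulrC;
  by move=> ?; lra.
Qed.

Lemma measurable_scaled_sample_set i v : measurable [set w | v <= Y i w].
Proof. by rewrite scaled_sample_set; exact: measurable_funPTI. Qed.

Lemma scaled_sample_prob i v : P [set w | v <= Y i w] = (F (x - h * v))%:E.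
Proof. by rewrite scaled_sample_set -(X_cdf i). Qed.

Lemma scaled_sample_indep i j u v : i != j ->
  P ([set w | u <= Y i w] `&` [set w | v <= Y j w]) =
  (F (x - h * u) * F (x - h * v))%:E.
Proof.
move=> ij.
(* Independence is stated for families indexed by all of [nat]; only the values of [A] at [i] and
   [j] matter, since the intersection is taken over [[fset i; j]]. *)
pose A k : set R :=
  if k == i then `]-oo, x - h * u]%classic else `]-oo, x - h * v]%classic.
have mA k : measurable (A k) by rewrite /A; case: ifP.
have Ai : A i = `]-oo, x - h * u]%classic by rewrite /A eqxx.
have Aj : A j = `]-oo, x - h * v]%classic by rewrite /A eq_sym (negPf ij).
have -> : [set w | u <= Y i w] `&` [set w | v <= Y j w] =
    \bigcap_(k in [set` [fset i; j]%fset]) X k @^-1` A k.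
  rewrite !scaled_sample_set -Ai -Aj; apply/seteqP; split => w /=.
    by move=> [wi wj] k /=; rewrite !inE => /orP[] /eqP ->.
  by move=> H; split; apply: H; rewrite /= !inE eqxx ?orbT.
rewrite X_indep// big_fsetU1 ?inE//= big_seq_fset1 EFinM.
by rewrite -(X_cdf i) -(X_cdf j) /cdf Ai Aj.
Qed.

Lemma cdf_itv01 y : 0 <= F y <= 1.
Proof. by rewrite -!lee_fin -(X_cdf 0) cdf_ge0 cdf_le1. Qed.

Lemma measurable_cdf : measurable_fun setT F.
Proof.
apply/measurable_EFinP; apply: eq_measurable_fun (cdf_measurable (X 0)) => y _.
by rewrite X_cdf.
Qed.

Variable G : R -> R.
Hypothesis iG : mu.-integrable setT (EFin \o G).

Lemma Kbar_sample_measurable i : measurable_fun setT (fun w => Kbar G (Y i w)).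
Proof.
apply: (measurableT_comp (Kbar_measurable iG)).
exact: measurable_scaled_sample.
Qed.

Lemma measurable_affine_cdf : measurable_fun setT (fun v => F (x - h * v)).
Proof.
apply: measurableT_comp measurable_cdf _.
by apply: measurable_funB => //; exact: measurable_funM.
Qed.

Lemma integrable_mul_cdf :
  mu.-integrable setT (EFin \o (fun v => G v * F (x - h * v))).
Proof.
apply: (integrable_dominated (M := 1) iG).
  apply: measurable_funM; last exact: measurable_affine_cdf.
  exact: lebesgue_integrable_measurable.
move=> v; rewrite mul1r normrM ler_piMr//.
by have /andP[F0 F1] := cdf_itv01 (x - h * v); rewrite ger0_norm.
Qed.

Lemma Rintegral_Kbar_sample i :
  \int[P]_w Kbar G (Y i w) = \int[mu]_v (G v * F (x - h * v)).
Proof.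
have i1 : P.-integrable setT (EFin \o (fun=> 1 : R)).
  exact: finite_measure_integrable_cst.
have := Rintegral_mul_Kbar iG i1 (measurable_scaled_sample i).
under eq_Rintegral do rewrite mul1r.
move=> ->; apply: eq_Rintegral => v _; congr (_ * _).
rewrite (Rintegral_cst P (measurable_scaled_sample_set i v)) mul1r.
by rewrite [X in fine X](scaled_sample_prob i v).
Qed.

(** Fubini is applied first in the [j]-th variable with weight [Kbar G (Y i)], then in the [i]-th
    one with an indicator as weight. What remains inside is the probability of a joint event, which
    factors by independence. *)
Lemma Rintegral_Kbar_sample_cross i j : i != j ->
  \int[P]_w (Kbar G (Y i w) * Kbar G (Y j w)) =
  (\int[mu]_v (G v * F (x - h * v))) * (\int[mu]_v (G v * F (x - h * v))).
Proof.
move=> ij.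
have mZ := Kbar_sample_measurable.
have iZ k : P.-integrable setT (EFin \o (fun w => Kbar G (Y k w))).
  by apply: bounded_measurable_integrable (mZ k) _ => w; exact: Kbar_bounded.
rewrite (Rintegral_mul_Kbar iG (iZ i) (measurable_scaled_sample j)).
have iGF : mu.-integrable setT (EFin \o (fun v => G v * F (x - h * v))).
  exact: integrable_mul_cdf.
rewrite -RintegralZl//; apply: eq_Rintegral => v _.
rewrite mulrCA; congr (_ * _).
pose Z w : R := \1_[set w | v <= Y j w] w.
have iZ1 : P.-integrable setT (EFin \o Z).
  exact: integrable_indic (measurable_scaled_sample_set j v).
transitivity (\int[P]_w (Z w * Kbar G (Y i w))).
  rewrite Rintegral_mkcond; apply: eq_Rintegral => w _.
  by rewrite patchE /Z indicE; case: ifPn => _; rewrite ?mul1r ?mul0r.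
rewrite (Rintegral_mul_Kbar iG iZ1 (measurable_scaled_sample i)).
rewrite mulrC -RintegralZl//; apply: eq_Rintegral => u _.
rewrite mulrCA; congr (_ * _).
rewrite /Rintegral integral_indic; last 2 first.
  exact: measurable_scaled_sample_set.
  exact: measurable_scaled_sample_set.
by rewrite [X in fine X]scaled_sample_indep// 1?eq_sym.
Qed.

End smoothed_sample.

(** * Exact mean and variance of the estimator as integrals against [F (x - h * v)] *)

Section moments_of_smoothed_sample.
Context d (T : measurableType d) (R : realType) (P : probability T R).
Variables (X : nat -> {RV P >-> R}) (F : R -> R).
Hypothesis X_indep : mutually_independent X.
Hypothesis X_cdf : forall i x, cdf (X i) x = (F x)%:E.
Local Notation mu := (@lebesgue_measure R).
Variables (h x : R) (G : R -> R) (n : nat).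
Hypotheses (h_gt0 : 0 < h) (n_gt0 : (0 < n)%N).
Hypothesis iG : mu.-integrable setT (EFin \o G).

Let m := \int[mu]_v (G v * F (x - h * v)).

Lemma expectation_Kbar_mean :
  'E_P[(fun w => n%:R^-1 * \sum_(i < n) Kbar G ((x - X i w) / h))%R]%E = m%:E.
Proof.
apply: (@expectation_mean _ _ _ _ (\int[mu]_v `|G v|) _
  (fun i w => Kbar G ((x - X i w) / h))) => //.
- by move=> i; exact: Kbar_sample_measurable.
- by move=> i w; exact: Kbar_bounded.
- by move=> i; exact: Rintegral_Kbar_sample.
Qed.

Lemma variance_Kbar_mean :
  'V_P[(fun w => n%:R^-1 * \sum_(i < n) Kbar G ((x - X i w) / h))%R]%E =
  ((\int[mu]_v (2 * Kbar G v * G v * F (x - h * v)) - m ^+ 2) / n%:R)%:E.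
Proof.
apply: (@variance_mean _ _ _ _ (\int[mu]_v `|G v|) _ _
  (fun i w => Kbar G ((x - X i w) / h))) => //.
- by move=> i; exact: Kbar_sample_measurable.
- by move=> i w; exact: Kbar_bounded.
- by move=> i; exact: Rintegral_Kbar_sample.
- move=> i.
  (* The second moment is a first moment for the kernel [2 * Kbar G * G], whose primitive is
     [Kbar G ^ 2]. *)
  rewrite -(Rintegral_Kbar_sample X_cdf x h_gt0 (integrable_mul_Kbar iG) i).
  by apply: eq_Rintegral => w _; rewrite Kbar_mul_Kbar// expr2.
- by move=> i j ij; exact: Rintegral_Kbar_sample_cross.
Qed.

End moments_of_smoothed_sample.

(** * Derivatives relative to [[a, b]] and a second-order Taylor estimate *)

Section derivative_within_interval.
Context (R : realType) (a b : R).
Implicit Types (g f : R -> R) (x y z : R).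

Lemma has_derive_within_continuous (A : set R) g g' :
  has_derive_within A g g' -> {within A, continuous g}.
Proof.
move=> dg; apply/subspace_continuousP => x Ax.
have : (g y - g x) / (y - x) * (y - x) @[y --> within A x^'] --> g' x * (x - x).
  apply: cvgM; first exact: dg.
  apply: cvgB; last exact: cvg_cst.
  by apply: (@cvg_trans _ (nbhs x)); [do 2 apply: cvg_within_filter|].
rewrite subrr mulr0 => h.
apply/cvgrPdist_lt => e e0.
move/cvgrPdist_lt : h => /(_ e e0); rewrite !near_withinE !near_simpl.
(* The limit of the quotient ignores [y = x], whereas continuity includes it; that case is
   trivial. *)
apply: filterS => y H Ay; have [->|yx] := eqVneq y x; first by rewrite subrr normr0.
have := H yx Ay.
by rewrite sub0r normrN divfK ?subr_eq0// distrC.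
Qed.

Lemma has_derive_within_is_derive g g' x : has_derive_within `[a, b] g g' ->
  x \in `]a, b[ -> is_derive x 1 g (g' x).
Proof.
move=> dg xab; have xab' : x \in `[a, b] by exact: subset_itv_oo_cc.
suff h : k^-1 *: (g (k *: 1 + x) - g x) @[k --> 0^'] --> g' x.
  split; first by apply/cvg_ex; exists (g' x).
  exact/cvg_lim/h.
have abx : \forall y \near x, `[a, b]%classic y.
  have : \forall y \near x, y \in `]a, b[ by exact: near_in_itvoo.
  by apply: filterS => y; exact: subset_itv_oo_cc.
apply/cvgrPdist_lt => e e0.
have /cvgrPdist_lt/(_ e e0) := dg x xab'; rewrite !near_withinE => H.
have {}H : \forall y \near x, y != x -> `|g' x - (g y - g x) / (y - x)| < e.
  by apply: filterS2 abx H => y Ay H yx; exact: H.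
(* Change of variable [y = k + x], from the quotient in [y] to the increment [k] of the library
   derivative. *)
have xc : k *: (1 : R) + x @[k --> 0] --> x.
  rewrite -[X in _ --> X]add0r -[X in _ --> X + _](scale0r (1 : R)).
  by apply: cvgD; [apply: cvgZr_tmp; exact: cvg_id|exact: cvg_cst].
have := xc _ H; rewrite near_simpl /= => {}H.
move: H; rewrite near_map; apply: filterS => k Hk k0.
have -> : k^-1 *: (g (k *: 1 + x) - g x) =
    (g (k *: 1 + x) - g x) / (k *: 1 + x - x).
  by rewrite addrK [k *: 1]mulr1 [RHS]mulrC.
by apply: Hk; rewrite -subr_eq0 addrK [k *: 1]mulr1.
Qed.

(** Covers both orders of [x] and [y]. The bound on [|z - x|] allows a second application between
    [x] and [z] in the Taylor estimate. *)
Lemma MVT_between f f' x y :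
  {within `[a, b], continuous f} ->
  (forall z, z \in `]a, b[ -> is_derive z 1 f (f' z)) ->
  x \in `[a, b] -> y \in `[a, b] ->
  exists2 z, z \in `[a, b] & `|z - x| <= `|y - x| /\ f y - f x = f' z * (y - x).
Proof.
move=> cf df.
have main (u v : R) : u \in `[a, b] -> v \in `[a, b] -> u <= v ->
    exists2 z, z \in `[u, v] & f v - f u = f' z * (v - u).
  move=> uab vab uv.
  have /andP[au ub] : a <= u <= b by move: uab; rewrite in_itv.
  have /andP[av vb] : a <= v <= b by move: vab; rewrite in_itv.
  have dfuv z : z \in `]u, v[ -> is_derive z 1 f (f' z).
    rewrite in_itv/= => /andP[uz zv]; apply: df.
    by rewrite in_itv/= (le_lt_trans au)// (lt_le_trans zv).
  have cfuv : {within `[u, v], continuous f}.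
    apply: continuous_subspaceW cf => z; rewrite /= !in_itv/= => /andP[uz zv].
    by rewrite (le_trans au)// (le_trans zv).
  exact: MVT_segment uv dfuv cfuv.
move=> xab yab; have [xy|/ltW yx] := leP x y.
  have [z zxy E] := main _ _ xab yab xy; exists z.
    by move: zxy xab yab; rewrite !in_itv/=; lra.
  by split=> //; move: zxy; rewrite in_itv/= => /andP[? ?]; rewrite !ger0_norm; lra.
have [z zxy E] := main _ _ yab xab yx; exists z.
  by move: zxy xab yab; rewrite !in_itv/=; lra.
split; last lra.
by move: zxy; rewrite in_itv/= => /andP[? ?]; rewrite !ler0_norm; lra.
Qed.

Variables (F g1 g2 : R -> R).
Hypothesis dF : has_derive_within `[a, b] F g1.
Hypothesis dg1 : has_derive_within `[a, b] g1 g2.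

Lemma derive1_within x : x \in `]a, b[ -> F^`()%classic x = g1 x.
Proof.
by move=> xab; rewrite derive1E; have [_ ->] := has_derive_within_is_derive dF xab.
Qed.

Lemma derive2_within x : x \in `]a, b[ -> F^`(2)%classic x = g2 x.
Proof.
move=> xab; rewrite /= derive1E.
have [_ <-] := has_derive_within_is_derive dg1 xab.
apply: near_eq_derive.
have : \forall y \near x, y \in `]a, b[ by exact: near_in_itvoo.
by apply: filterS => y yab; exact: derive1_within.
Qed.

(** After subtracting the quadratic polynomial, the mean value theorem is used twice, first for the
    difference and then for [g1]; the error becomes [(z - x) * (g2 u - c) * (y - x)]. The
    coefficient [c] is free: the bias takes [c = g2 x], the variance [c = 0]. *)
Lemma taylor2_within (c w x y : R) : x \in `[a, b] -> y \in `[a, b] ->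
  (forall z, z \in `[a, b] -> `|z - x| <= `|y - x| -> `|g2 z - c| <= w) ->
  `|F y - F x - (y - x) * g1 x - (y - x) ^+ 2 / 2 * c| <= w * (y - x) ^+ 2.
Proof.
move=> xab yab g2c.
pose q z := (z - x) * g1 x + (z - x) ^+ 2 / 2 * c.
pose f := F \- q.
have dq (z : R) : is_derive z 1 q (g1 x + (z - x) * c).
  by rewrite /q; apply: is_derive_eq; rewrite /GRing.scale /=; field.
have df z : z \in `]a, b[ -> is_derive z 1 f (g1 z - (g1 x + (z - x) * c)).
  move=> zab; apply: is_deriveB; exact: has_derive_within_is_derive.
have cf : {within `[a, b], continuous f}.
  move=> z; apply: continuousB; first exact: has_derive_within_continuous dF z.
  apply: continuous_subspaceT => {}z.
  apply/differentiable_continuous/derivable1_diffP.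
  by have [] := dq z.
have [z zab [zx E]] := MVT_between cf df xab yab.
have [u uab [uz E1]] := MVT_between (has_derive_within_continuous dg1)
  (fun z => @has_derive_within_is_derive _ _ z dg1) xab zab.
have -> : F y - F x - (y - x) * g1 x - (y - x) ^+ 2 / 2 * c = f y - f x.
  by rewrite /f /q /=; ring.
rewrite E (_ : _ - _ = (z - x) * (g2 u - c)); last first.
  by rewrite opprD addrA E1; ring.
have -> : (y - x) ^+ 2 = `|y - x| * `|y - x|.
  by rewrite -expr2 -normrX ger0_norm ?sqr_ge0.
rewrite !normrM mulrA ler_wpM2r//.
rewrite mulrC ler_pM//.
by apply: g2c => //; exact: le_trans zx.
Qed.

End derivative_within_interval.

(** * The value of [F] at [a], and suprema of bounded families *)

Lemma cdf_left_endpoint d (T : measurableType d) (R : realType)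
    (P : probability T R) (X : {RV P >-> R}) (f F : R -> R) (a b : R) :
  has_density X f -> (forall x, cdf X x = (F x)%:E) ->
  fun_support f = `[a, b]%classic -> F a = 0.
Proof.
move=> [mf f0 Xf] XF supp; apply: EFin_inj; rewrite -XF /cdf Xf//.
(* The point [a] has measure zero and [f] vanishes to its left. *)
rewrite -integral_itv_bndo_bndc; last first.
  apply: measurable_funTS.
  exact/measurable_EFinP.
rewrite integral0_eq// => x /=; rewrite in_itv/= => xa; congr EFin.
apply/eqP; apply: contraTT xa => fx.
have : fun_support f x by exact: subset_closure.
by rewrite supp /= in_itv/= -leNgt => /andP[].
Qed.

(** Nonemptiness of [D] keeps the supremum from being [-oo]: any value of [g] bounds it below by
    0. *)
Lemma ereal_sup_bounded (R : realType) (I : Type) (D : set I) (g : I -> R) (B : R) :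
  D !=set0 -> (forall x, D x -> 0 <= g x <= B) ->
  let s := ereal_sup [set (g x)%:E | x in D] in
  s \is a fin_num /\ `|fine s| <= B.
Proof.
move=> [x Dx] gB s.
have sB : (s <= B%:E)%E.
  by apply: ge_ereal_sup => _ [y Dy <-]; rewrite lee_fin; have /andP[] := gB y Dy.
have s0 : (0 <= s)%E.
  apply: (@le_trans _ _ (g x)%:E); last by apply: ereal_sup_ubound; exists x.
  by rewrite lee_fin; have /andP[] := gB x Dx.
have sfin : s \is a fin_num.
  by rewrite ge0_fin_numE// (le_lt_trans sB)// ltry.
by split=> //; rewrite ger0_norm ?fine_ge0// -lee_fin fineK.
Qed.

(** * Replacing [F] by a quadratic polynomial under the kernel integral *)

Section smoothing_remainder.
Context (R : realType).
Local Notation mu := (@lebesgue_measure R).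
Variables (F G : R -> R) (alpha h x p c W : R).
Hypotheses (alpha01 : 0 < alpha < 1).
Hypothesis iG : mu.-integrable setT (EFin \o G).
Hypothesis Gsupp : forall v, G v != 0 -> -1 <= v <= alpha.
Hypothesis iGF : mu.-integrable setT (EFin \o (fun v => G v * F (x - h * v))).
Hypothesis FW : forall v, -1 <= v <= alpha ->
  `|F (x - h * v) - (F x - h * v * p + (h * v) ^+ 2 / 2 * c)| <= W.

Lemma integrable_moment k : mu.-integrable setT (EFin \o (fun v => v ^+ k * G v)).
Proof.
apply: (integrable_dominated (M := 1) iG).
  apply: measurable_funM; last exact: lebesgue_integrable_measurable.
  by apply: measurable_funX; exact: measurable_id.
move=> v; have [->|/Gsupp/andP[v1 va]] := eqVneq (G v) 0.
  by rewrite mulr0 normr0 mulr0.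
rewrite mul1r normrM ler_piMl// normrX exprn_ile1//.
by rewrite ler_norml v1/= (le_trans va)//; move: alpha01; lra.
Qed.

(** The quadratic in [h * v] integrates to a combination of the moments of order 0, 1 and 2, and on
    the support of [G] the pointwise error is at most [W]. It is used for the boundary kernel and
    for the kernel of the squared smoother. *)
Lemma smoothing_remainder :
  `|\int[mu]_v (G v * F (x - h * v)) -
    (F x * \int[mu]_v (v ^+ 0 * G v) - h * p * \int[mu]_v (v ^+ 1 * G v)
     + h ^+ 2 / 2 * c * \int[mu]_v (v ^+ 2 * G v))| <= W * \int[mu]_v `|G v|.
Proof.
pose Q v := F x * (v ^+ 0 * G v) - h * p * (v ^+ 1 * G v)
  + h ^+ 2 / 2 * c * (v ^+ 2 * G v).
have im k y : mu.-integrable setT (EFin \o (fun v => y * (v ^+ k * G v))).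
  by apply: integrableZl_EFin; exact: integrable_moment.
have iQ1 := integrableB_EFin (im 0 (F x)) (im 1 (h * p)).
have iQ : mu.-integrable setT (EFin \o Q).
  exact: integrableD_EFin iQ1 (im 2 _).
have -> : F x * \int[mu]_v (v ^+ 0 * G v) - h * p * \int[mu]_v (v ^+ 1 * G v)
     + h ^+ 2 / 2 * c * \int[mu]_v (v ^+ 2 * G v) = \int[mu]_v Q v.
  rewrite /Q (RintegralD measurableT iQ1 (im 2 _)).
  rewrite (RintegralB measurableT (im 0 _) (im 1 _)).
  by rewrite !(RintegralZl _ measurableT (integrable_moment _)).
rewrite -RintegralB//; apply: normr_Rintegral_dominated => //.
  apply: (@lebesgue_integrable_measurable _ (fun v => G v * F (x - h * v) - Q v)).
  exact: integrableB_EFin.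
move=> v; have [G0|/Gsupp/FW] := eqVneq (G v) 0.
  by rewrite /Q G0 !(mul0r, mulr0, addr0, subr0, normr0).
have -> : G v * F (x - h * v) - Q v =
    (F (x - h * v) - (F x - h * v * p + (h * v) ^+ 2 / 2 * c)) * G v.
  by rewrite /Q; field.
by move=> FWv; rewrite normrM ler_wpM2r.
Qed.

End smoothing_remainder.

(** * Bias and variance at a fixed point of the left boundary region *)

Section boundary_region.
Context d (T : measurableType d) (R : realType) (P : probability T R).
Local Notation mu := (@lebesgue_measure R).
Variables (X : nat -> {RV P >-> R}) (F g1 g2 : R -> R) (a b h x C : R).
Variable (KL : R -> R -> R).
Hypothesis X_cdf : forall i y, cdf (X i) y = (F y)%:E.
Hypothesis Fa0 : F a = 0.
Hypothesis dF : has_derive_within `[a, b] F g1.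
Hypothesis dg1 : has_derive_within `[a, b] g1 g2.
Hypothesis h_bounds : 0 < h <= (b - a) / 2.
Hypothesis x_bounds : a < x < a + h.
Local Notation alpha := ((x - a) / h).
Hypothesis iKL : mu.-integrable setT (EFin \o KL alpha).
Hypothesis KL_supp : forall v, KL alpha v != 0 -> -1 <= v <= alpha.
Hypothesis KL_C : \int[mu]_v `|KL alpha v| <= C.
Hypothesis KL_moment :
  alpha * (1 - moment KL 0 alpha) + moment KL 1 alpha = 0.

Let h_gt0 : 0 < h. Proof. by case/andP: h_bounds. Qed.

Lemma boundary_alpha01 : 0 < alpha < 1.
Proof. by rewrite divr_gt0 ?ltr_pdivrMr//; move: x_bounds; lra. Qed.

Let h_alpha : h * alpha = x - a.
Proof. by rewrite mulrC divfK// gt_eqF. Qed.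

Lemma boundary_taylor (c w v : R) : -1 <= v <= alpha ->
  (forall z, a <= z <= a + 2 * h -> `|g2 z - c| <= w) ->
  `|F (x - h * v) - (F x - h * v * g1 x + (h * v) ^+ 2 / 2 * c)| <= w * h ^+ 2.
Proof.
move=> /andP[v1 va] g2c.
(* With [a < x < a + h], these two bounds place [x - h * v] in [[a, a + 2 h]], which lies in
   [[a, b]] since [h <= (b - a) / 2]. *)
have hv1 : - h <= h * v by rewrite -mulrN1 ler_pM2l.
have hva : h * v <= x - a by rewrite -h_alpha ler_pM2l.
have hx := x_bounds; have hb := h_bounds.
have xab : x \in `[a, b] by rewrite in_itv/=; lra.
have yab : x - h * v \in `[a, b] by rewrite in_itv/=; lra.
have yx : x - h * v - x = - (h * v) by ring.
have w0 : 0 <= w.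
  by apply: le_trans (normr_ge0 _) (g2c a _); lra.
have hvh : `|h * v| <= h by rewrite ler_norml; lra.
have := @taylor2_within _ _ _ _ _ _ dF dg1 c w x (x - h * v) xab yab.
rewrite yx normrN sqrrN => H.
have -> : F (x - h * v) - (F x - h * v * g1 x + (h * v) ^+ 2 / 2 * c) =
    F (x - h * v) - F x - - (h * v) * g1 x - (h * v) ^+ 2 / 2 * c by ring.
apply: (le_trans (H _)).
  move=> z; rewrite in_itv/= => /andP[az zb] zx; apply: g2c.
  by move: (le_trans zx hvh); rewrite ler_norml; lra.
rewrite ler_wpM2l// -(ger0_norm (sqr_ge0 (h * v))) normrX.
by rewrite ler_pXn2r ?nnegrE// ltW.
Qed.

Let m := \int[mu]_v (KL alpha v * F (x - h * v)).
Let s := \int[mu]_v (2 * Kbar (KL alpha) v * KL alpha v * F (x - h * v)).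

Lemma moment0_bounded : `|moment KL 0 alpha| <= C.
Proof.
apply: le_trans KL_C; rewrite /moment.
under eq_Rintegral do rewrite expr0 mul1r.
by apply: le_trans (le_normr_Rintegral _ iKL) _.
Qed.

(** At [v = alpha] the evaluation point is [a], where [F] vanishes, so the Taylor polynomial itself
    is of the size of the remainder. *)
Lemma boundary_taylor_left (c w : R) :
  (forall z, a <= z <= a + 2 * h -> `|g2 z - c| <= w) ->
  `|F x - h * alpha * g1 x + (h * alpha) ^+ 2 / 2 * c| <= w * h ^+ 2.
Proof.
move=> g2c; have := boundary_taylor _ g2c (v := alpha).
rewrite {1}h_alpha opprB addrCA subrr addr0 Fa0 sub0r normrN; apply.
by have := boundary_alpha01; lra.
Qed.

Lemma boundary_taylor_ge0 (c w : R) :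
  (forall z, a <= z <= a + 2 * h -> `|g2 z - c| <= w) -> 0 <= w * h ^+ 2.
Proof.
by move=> g2c; exact: le_trans (normr_ge0 _) (boundary_taylor_left g2c).
Qed.

(** Let [A] be the smoothing remainder and [B] the Taylor polynomial at [a]. The moment condition
    makes the centred error equal to [A - (1 - mu0) * B]: the terms in [g1 x] cancel and
    [mu2 + alpha ^+ 2 * (1 - mu0)] becomes [muL]. The two pieces contribute [C] and [1 + C] to the
    constant. *)
Lemma boundary_bias (w : R) :
  (forall z, a <= z <= a + 2 * h -> `|g2 z - g2 x| <= w) ->
  `|m - F x - h ^+ 2 / 2 * g2 x * muL KL alpha| <= (2 * C + 1) * (w * h ^+ 2).
Proof.
move=> g2w.
have := smoothing_remainder boundary_alpha01 iKL KL_supp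
  (integrable_mul_cdf X_cdf h x iKL)
  (fun v hv => boundary_taylor hv g2w).
have := boundary_taylor_left g2w.
have W0 := boundary_taylor_ge0 g2w.
move: KL_C moment0_bounded KL_moment.
rewrite -/m /muL -!/(moment KL _ alpha).
move: (moment KL 0 alpha) (moment KL 1 alpha) (moment KL 2 alpha) W0.
move: (w * h ^+ 2) alpha => W al mu0 mu1 mu2 W0 KLC mu0C mu1E.
set B := F x - _ + _ => BW; set A := m - _ => AW.
have -> : m - F x - h ^+ 2 / 2 * g2 x * (mu2 - al * mu1) = A - (1 - mu0) * B.
  have E : mu1 = - al * (1 - mu0) by move: mu1E; lra.
  by rewrite /A /B E; field.
have AC : `|A| <= W * C by rewrite (le_trans AW)// ler_wpM2l.
have BC : `|(1 - mu0) * B| <= (1 + C) * W.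
  rewrite normrM ler_pM// (le_trans (ler_normB _ _))// normr1.
  by rewrite lerD2l.
by rewrite (le_trans (ler_normB _ _))//; lra.
Qed.

Let C_ge0 : 0 <= C.
Proof. by apply: le_trans KL_C; apply: Rintegral_ge0. Qed.

Lemma boundary_mean_bounded : `|m| <= C.
Proof.
apply: le_trans KL_C; rewrite -[leRHS]mul1r.
apply: normr_Rintegral_dominated => //.
  exact: (lebesgue_integrable_measurable (integrable_mul_cdf X_cdf h x iKL)).
move=> v; rewrite mul1r normrM ler_piMr//.
by have /andP[F0 F1] := cdf_itv01 X_cdf (x - h * v); rewrite ger0_norm.
Qed.

(** First-order expansions suffice here, hence [c = 0] and a plain bound [M] on [g2]. The error
    splits as [A2 - (m - F x) * (m + F x) - (1 - mu0 ^+ 2) * B], with [A2] the remainder for the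
    kernel of the square; the three terms give the three summands of the constant. *)
Lemma boundary_variance (M : R) :
  (forall z, a <= z <= a + 2 * h -> `|g2 z| <= M) ->
  `|s - m ^+ 2 - F x * (1 - F x) + h * g1 x * nuL KL alpha|
    <= (2 * C ^+ 2 + (2 * C + 1) * (C + 1) + (1 + C ^+ 2)) * (M * h ^+ 2).
Proof.
move=> g2M.
have g2M0 z : a <= z <= a + 2 * h -> `|g2 z - 0| <= M.
  by rewrite subr0; exact: g2M.
have iB := integrable_mul_Kbar iKL.
have B_supp v : 2 * Kbar (KL alpha) v * KL alpha v != 0 -> -1 <= v <= alpha.
  by rewrite mulf_eq0 negb_or => /andP[_]; exact: KL_supp.
have := smoothing_remainder boundary_alpha01 iKL KL_supp
  (integrable_mul_cdf X_cdf h x iKL)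
  (fun v hv => boundary_taylor hv g2M0).
have := smoothing_remainder boundary_alpha01 iB B_supp
  (integrable_mul_cdf X_cdf h x iB)
  (fun v hv => boundary_taylor hv g2M0).
have := boundary_taylor_left g2M0.
have W0 := boundary_taylor_ge0 g2M0.
(* One factor [C] bounds [Kbar] uniformly, the other is the integral of [|KL alpha|]. *)
have IB : \int[mu]_v `|2 * Kbar (KL alpha) v * KL alpha v| <= 2 * C ^+ 2.
  have mB : measurable_fun [set: measurableTypeR R]
      (fun v => `|2 * Kbar (KL alpha) v * KL alpha v|).
    exact: measurableT_comp (measurable_mul_Kbar iKL).
  have := normr_Rintegral_dominated (M := 2 * \int[mu]_u `|KL alpha u|) iKL mB.
  move=> /(_ _)/(le_trans (ler_norm _)) H; apply: (le_trans (H _)) => [v|].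
    by rewrite normr_id; exact: Kbar_dominated.
  rewrite -mulrA ler_pM2l// expr2 ler_pM// Rintegral_ge0//.
have -> : \int[mu]_v (v ^+ 0 * (2 * Kbar (KL alpha) v * KL alpha v)) =
    moment KL 0 alpha ^+ 2.
  under eq_Rintegral do rewrite expr0 mul1r.
  rewrite Rintegral_mul_Kbar_sq// /moment.
  by under [in RHS]eq_Rintegral do rewrite expr0 mul1r.
have -> : \int[mu]_v (v ^+ 1 * (2 * Kbar (KL alpha) v * KL alpha v)) =
    m1L KL alpha by [].
move: KL_C moment0_bounded boundary_mean_bounded KL_moment.
have /andP[F0 F1] := cdf_itv01 X_cdf x.
rewrite -/m -/s /nuL -!/(moment KL _ alpha) !mulr0 !mul0r !addr0.
move: (moment KL 0 alpha) (moment KL 1 alpha) (m1L KL alpha) W0.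
move: (M * h ^+ 2) alpha IB => W al IB mu0 mu1 m1 W0 KLC mu0C mC mu1E.
set B := F x - _ => BW; set A2 := s - _ => A2W; set A := m - _ => AW.
have AC : `|A| <= W * C by rewrite (le_trans AW)// ler_wpM2l.
have A2C : `|A2| <= W * (2 * C ^+ 2) by rewrite (le_trans A2W)// ler_wpM2l.
have mF : `|m - F x| <= (2 * C + 1) * W.
  have -> : m - F x = A - (1 - mu0) * B.
    have E : mu1 = - al * (1 - mu0) by move: mu1E; lra.
    by rewrite /A /B E; ring.
  have BC : `|(1 - mu0) * B| <= (1 + C) * W.
    rewrite normrM ler_pM// (le_trans (ler_normB _ _))// normr1.
    by rewrite lerD2l.
  by rewrite (le_trans (ler_normB _ _))//; lra.
have -> : s - m ^+ 2 - F x * (1 - F x) + h * g1 x * (m1 + al * (1 - mu0 ^+ 2)) =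
    A2 - (m - F x) * (m + F x) - (1 - mu0 ^+ 2) * B.
  by rewrite /A2 /B; ring.
have E1 : `|(m - F x) * (m + F x)| <= (2 * C + 1) * W * (C + 1).
  rewrite normrM ler_pM// (le_trans (ler_normD _ _))// lerD//.
  by rewrite ger0_norm.
have E2 : `|(1 - mu0 ^+ 2) * B| <= (1 + C ^+ 2) * W.
  rewrite normrM ler_pM// (le_trans (ler_normB _ _))// normr1 lerD2l normrX.
  by rewrite ler_pXn2r ?nnegrE.
rewrite (le_trans (ler_normB _ _))// (le_trans (lerD (ler_normB _ _) (lexx _)))//.
lra.
Qed.

End boundary_region.

(** * Estimates uniform over the boundary region, and the two asymptotic statements *)

Lemma abs_moment0_bounded (R : realType) (KL : R -> R -> R) :
  is_left_boundary_kernel KL ->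
  (ereal_sup [set abs_moment0 KL alpha | alpha in `]0%R, 1%R[%classic] < +oo)%E ->
  exists2 C : R, 0 <= C & forall alpha, alpha \in `]0, 1[ ->
    \int[lebesgue_measure]_v `|KL alpha v| <= C.
Proof.
move=> kerKL supKL; set s := ereal_sup _ in supKL.
have sup_ge alpha : alpha \in `]0, 1[ -> (abs_moment0 KL alpha <= s)%E.
  by move=> al01; apply: ereal_sup_ubound; exists alpha.
have m_ge0 alpha : (0 <= abs_moment0 KL alpha)%E by exact: integral_ge0.
(* One admissible [alpha] shows that the supremum is nonnegative, hence finite, so [fine s] is a
   genuine bound. *)
have half01 : (2^-1 : R) \in `]0, 1[ by rewrite in_itv/=; lra.
have s_ge0 : (0 <= s)%E := le_trans (m_ge0 _) (sup_ge _ half01).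
have sfin : s \is a fin_num by rewrite ge0_fin_numE.
exists (fine s); first exact: fine_ge0.
move=> alpha al01; have := sup_ge _ al01; rewrite /Rintegral -/(abs_moment0 KL alpha).
move=> le_s; rewrite fine_le// ge0_fin_numE// (le_lt_trans le_s)//.
Qed.

Lemma continuous_within_left (R : realType) (a b : R) (g : R -> R) (e : R) :
  a < b -> {within `[a, b], continuous g} -> 0 < e ->
  exists2 r : R, 0 < r & forall z, z \in `[a, b] -> z <= a + r -> `|g z - g a| <= e.
Proof.
move=> ab /subspace_continuousP cg e0.
have /cvgrPdist_le/(_ e e0) : g y @[y --> within `[a, b]%classic (nbhs a)] --> g a.
  by apply: cg; rewrite /= in_itv/= lexx ltW.
(* Halving turns the open ball into a closed range [z <= a + r / 2]. *)
rewrite near_withinE => /nbhs_ballP[r /= r0 H]; exists (r / 2); first lra.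
move=> z zab zr; rewrite distrC; apply: H => //=.
move: zab; rewrite in_itv/= => /andP[az _].
by rewrite /ball/= distrC ger0_norm; lra.
Qed.

Theorem theorem1 (R : realType) (d : measure_display) (T : measurableType d)
    (P : probability T R) (X : nat -> {RV P >-> R}) (f F : R -> R) (a b : R)
    (K : R -> R) (KL : R -> R -> R) (h : nat -> R)
    (ab : a < b)
    (X_indep : mutually_independent X)
    (X_density : forall i, has_density (X i) f)
    (X_cdf : forall i x, cdf (X i) x = (F x)%:E)
    (f_support : fun_support f = `[a, b]%classic)
    (K_kernel : is_kernel K)
    (KL_kernel : is_left_boundary_kernel KL)
    (h_bounds : forall n, (0 < n)%N -> 0 < h n <= (b - a) / 2)
    (h_cvg0 : h n @[n --> \oo] --> 0)
    (KL_moments : forall alpha : R, alpha \in `]0, 1[ ->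
      alpha * (1 - moment KL 0 alpha) + moment KL 1 alpha = 0)
    (KL_sup : (ereal_sup [set abs_moment0 KL alpha | alpha in `]0%R, 1%R[%classic]
                 < +oo)%E)
    (F_C2 : twice_continuously_differentiable_within `[a, b]%classic F) :
  elittleo
    (fun n => ereal_sup
       [set `| 'E_P[Ftilde X K KL a b n (h n) x]
               - (F x)%:E
               - (h n ^+ 2 / 2 * F^`(2)%classic x * muL KL ((x - a) / h n))%:E |%E
       | x in `]a, a + h n[%classic])
    (fun n => h n ^+ 2)
  /\
  ebigO
    (fun n => ereal_sup
       [set `| 'V_P[Ftilde X K KL a b n (h n) x]
               - (F x * (1 - F x) / n%:R)%:E
               + (h n / n%:R * F^`()%classic x * nuL KL ((x - a) / h n))%:E |%E
       | x in `]a, a + h n[%classic])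
    (fun n => n%:R^-1 * h n ^+ 2).
Proof.
have [g1 [g2 [dF dg1 cg2]]] := F_C2.
have [C C0 KL_C] := abs_moment0_bounded KL_kernel KL_sup.
have Fa0 : F a = 0 := cdf_left_endpoint (X_density 0) (X_cdf 0) f_support.
have FtildeE n x : (0 < n)%N -> x \in `]a, a + h n[ ->
    Ftilde X K KL a b n (h n) x = (fun w =>
      n%:R^-1 * \sum_(i < n) Kbar (KL ((x - a) / h n)) ((x - X i w) / h n)).
  move=> n0; rewrite in_itv/= => /andP[ax xah]; apply/funext => w.
  have := h_bounds n n0 => hb.
  rewrite /Ftilde leNgt ax/= ifF; last by apply/negbTE; rewrite -ltNge; lra.
  by congr (_ * _); apply: eq_bigr => i _; rewrite /Kbar_xh xah.
have xoo n x : (0 < n)%N -> x \in `]a, a + h n[ -> x \in `]a, b[.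
  by move=> n0; have := h_bounds n n0; rewrite !in_itv/=; lra.
have al01 n x : (0 < n)%N -> x \in `]a, a + h n[ -> (x - a) / h n \in `]0, 1[.
  move=> n0 xah; rewrite in_itv; apply: boundary_alpha01 (h_bounds n n0) _.
  by move: xah; rewrite in_itv.
have supp (al v : R) : al \in `]0, 1[ -> KL al v != 0 -> -1 <= v <= al.
  move=> /KL_kernel[sup _] KLv.
  have KLv' : fun_support (KL al) v by exact: subset_closure.
  by have := sup v KLv'; rewrite /= in_itv.
have nonempty n : (0 < n)%N -> `]a, a + h n[%classic !=set0.
  by move=> n0; exists (a + h n / 2); have := h_bounds n n0; rewrite /= in_itv/=; lra.
(* All the points where [F] is evaluated lie within [2 h] of [a], so continuity
   of the second derivative at [a] alone gives the uniform estimates. *)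
have near_left e : 0 < e -> \forall n \near \oo, (0 < n)%N /\
    forall z, a <= z <= a + 2 * h n -> `|g2 z - g2 a| <= e.
  move=> e0; have [r r0 Hr] := continuous_within_left ab cg2 e0.
  have hr : \forall n \near \oo, `|h n| <= r / 2.
    by move/cvgr0Pnorm_le : h_cvg0; apply; lra.
  near=> n; have n0 : (0 < n)%N by near: n; exact: nbhs_infty_gt.
  split=> // z /andP[az zah]; have hb := h_bounds n n0.
  have : `|h n| <= r / 2 by near: n.
  rewrite ler_norml => hrn; apply: Hr; last lra.
  by rewrite in_itv/=; lra.
split.
(* Finiteness and the bound are proved together, since [fine] carries information only when the
   supremum is finite. *)
- suff H e : 0 < e -> \forall n \near \oo,
      let s := ereal_sup [set `| 'E_P[Ftilde X K KL a b n (h n) x]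
         - (F x)%:E
         - (h n ^+ 2 / 2 * F^`(2)%classic x * muL KL ((x - a) / h n))%:E |%E
         | x in `]a, a + h n[%classic] in
      s \is a fin_num /\ `|fine s| <= e * h n ^+ 2.
    split; first by apply: filterS (H 1 ltr01) => n [].
    apply/eqoP => e e0; apply: filterS (H e e0) => n [_].
    by rewrite (ger0_norm (sqr_ge0 _)).
  (* [near_left] compares [g2] with its value at [a]; passing through [a] to compare with [g2 x]
     costs a factor 2, and [boundary_bias] costs [2 * C + 1]. *)
  move=> e0; pose w := e / (2 * (2 * C + 1)).
  have w0 : 0 < w by rewrite divr_gt0//; lra.
  apply: filterS (near_left w w0) => n [n0 g2w].
  set S := [set _ | x in _].
  pose A x := `|\int[lebesgue_measure]_v (KL ((x - a) / h n) v * F (x - h n * v))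
    - F x - h n ^+ 2 / 2 * g2 x * muL KL ((x - a) / h n)|.
  have -> : S = [set (A x)%:E | x in `]a, a + h n[%classic].
    apply: eq_imagel => x xah.
    have /KL_kernel[_ iK] := al01 _ _ n0 xah.
    rewrite FtildeE// (expectation_Kbar_mean X_cdf)//; last first.
      by case/andP: (h_bounds n n0).
    by rewrite (derive2_within dF dg1)//; exact: xoo xah.
  apply: ereal_sup_bounded; first exact: nonempty.
  move=> x xah; rewrite /A normr_ge0/=.
  have al := al01 _ _ n0 xah; have /KL_kernel[_ iK] := al.
  have xah' : a < x < a + h n by move: xah; rewrite /= in_itv.
  have -> : e * h n ^+ 2 = (2 * C + 1) * (2 * w * h n ^+ 2).
    by rewrite /w; field; lra.
  apply: (boundary_bias X_cdf Fa0 dF dg1 (h_bounds n n0) xah' iK) => //.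
  + by move=> v; exact: supp.
  + exact: KL_C.
  + exact: KL_moments.
  move=> z zah; have -> : g2 z - g2 x = (g2 z - g2 a) - (g2 x - g2 a) by ring.
  rewrite (le_trans (ler_normB _ _))// mulr_natl mulr2n lerD// g2w//.
  by move: xah' (h_bounds n n0); lra.
(* Tolerance 1 in [near_left] makes [M] a bound for [g2] on [[a, a + 2 h]] for all large [n]. *)
- pose M := `|g2 a| + 1.
  pose B := (2 * C ^+ 2 + (2 * C + 1) * (C + 1) + (1 + C ^+ 2)) * M.
  have B0 : 0 < B.
    rewrite mulr_gt0//; first by have := sqr_ge0 C; nra.
    by rewrite ltr_wpDl.
  suff H : \forall n \near \oo,
      let s := ereal_sup [set `| 'V_P[Ftilde X K KL a b n (h n) x]
               - (F x * (1 - F x) / n%:R)%:E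
               + (h n / n%:R * F^`()%classic x * nuL KL ((x - a) / h n))%:E |%E
               | x in `]a, a + h n[%classic] in
      s \is a fin_num /\ `|fine s| <= B * (n%:R^-1 * h n ^+ 2).
    split; first by apply: filterS H => n [].
    apply/eqO_exP; exists B => //; apply: filterS H => n [_ le_s].
    by rewrite (le_trans le_s)// ler_wpM2l ?ler_norm// ltW.
  apply: filterS (near_left 1 ltr01) => n [n0 g2w].
  set S := [set _ | x in _].
  (* All three terms carry [1 / n]; pulling it out leaves exactly the quantity bounded by
     [boundary_variance]. *)
  pose A x := n%:R^-1 * `|\int[lebesgue_measure]_v
      (2 * Kbar (KL ((x - a) / h n)) v * KL ((x - a) / h n) v * F (x - h n * v))
    - (\int[lebesgue_measure]_v (KL ((x - a) / h n) v * F (x - h n * v))) ^+ 2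
    - F x * (1 - F x) + h n * g1 x * nuL KL ((x - a) / h n)|.
  have -> : S = [set (A x)%:E | x in `]a, a + h n[%classic].
    apply: eq_imagel => x xah.
    have /KL_kernel[_ iK] := al01 _ _ n0 xah.
    rewrite FtildeE// (variance_Kbar_mean X_indep X_cdf)//; last first.
      by case/andP: (h_bounds n n0).
    rewrite (derive1_within dF); last exact: xoo xah.
    have normn Y : n%:R^-1 * `|Y| = `|n%:R^-1 * Y| :> R.
      by rewrite normrM (@ger0_norm _ n%:R^-1).
    by rewrite /A normn /=; congr (`|_|%:E); ring.
  apply: ereal_sup_bounded; first exact: nonempty.
  move=> x xah; rewrite /A mulr_ge0//=.
  have al := al01 _ _ n0 xah; have /KL_kernel[_ iK] := al.
  have xah' : a < x < a + h n by move: xah; rewrite /= in_itv.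
  rewrite mulrCA ler_wpM2l// /B -[_ * M * _]mulrA.
  apply: (boundary_variance X_cdf Fa0 dF dg1 (h_bounds n n0) xah' iK) => //.
  + by move=> v; exact: supp.
  + exact: KL_C.
  + exact: KL_moments.
  move=> z zah; have -> : g2 z = g2 a + (g2 z - g2 a) by ring.
  by rewrite (le_trans (ler_normD _ _))// lerD2l g2w.
Unshelve. all: by end_near. Qed.
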